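(* Let $n\ge 7$ be odd with $5\mid n$. Then $\mathcal K_n=\{3,4,\dots,n-3\}$.
   Context: The multiplicative inverse function $f_{\mathrm{inv}}$ of $\mathbb F_{2^n}$ is defined by $f_{\mathrm{inv}}(x)=x^{-1}$ for $x\ne 0$ and $f_{\mathrm{inv}}(0)=0$. A function $f:\mathbb F_{2^n}\to\mathbb F_{2^n}$ is $k$th order sum-free if $\sum_{x\in A}f(x)\ne 0$ for every $k$-dimensional $\mathbb F_2$-affine subspace $A$ of $\mathbb F_{2^n}$. For $n\ge 2$, $\mathcal K_n=\{1\le k\le n-1: f_{\mathrm{inv}}\text{ is not $k$th order sum-free on }\mathbb F_{2^n}\}$. (The paper states this as ''if $5\mid n$ then the conjecture $\mathcal K_n=\{3,\dots,n-3\}$ for odd $n\ge 7$ holds for $n$''.) *)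

(* Defs.v *)
From mathcomp Require Import all_boot all_order all_algebra all_field.

Set Implicit Arguments.
Unset Strict Implicit.
Unset Printing Implicit Defensive.

Import GRing.Theory.
Local Open Scope ring_scope.

(* F_{2^n} is represented as an extension L of 'F_2 of dimension n;
   finvect_type L is the same field equipped with its finType structure. *)

Definition f_inv (L : fieldExtType 'F_2) (x : finvect_type L) : finvect_type L :=
  if x == 0 then 0 else x^-1.

Definition affine_subspace (L : fieldExtType 'F_2) (k : nat)
    (A : {set finvect_type L}) : Prop :=
  exists (a : finvect_type L) (V : {vspace finvect_type L}),
    \dim V = k /\ A = [set a + v | v in V].

Definition sum_free (L : fieldExtType 'F_2) (k : nat)
    (f : finvect_type L -> finvect_type L) : Prop :=
  forall A : {set finvect_type L},
    affine_subspace k A -> \sum_(x in A) f x <> 0.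

(* Membership k \in K_n, with n = \dim {:L}. *)
Definition calK (L : fieldExtType 'F_2) (k : nat) : Prop :=
  (1 <= k <= (\dim {:L}).-1)%N /\ ~ sum_free k (@f_inv L).

(* Main.v *)
(* For a subspace V with subspace polynomial L_V(X) = prod_(u in V) (X + u),
   sum_(u in V) 1/(a + u) = a0(V) / L_V(a) is nonzero for a outside V, so only
   linear subspaces matter, and with S(V) = sum_(u in V, u != 0) 1/u one has
     S(V + W) = S(V) + a0(V) S(L_V(W))     (V, W independent).
   Applied to V + W = F_{2^n} this gives the duality k <-> n - k, since
   S(F_{2^n}) = 0; as k = 1, 2 are impossible for n odd, so are n - 1, n - 2.
   It also glues vanishing subspaces: one of dimension k, followed by a
   multiple of one of dimension d fitting in the image of L_V (k d < n), or by
   an F_32-subspace, on which S vanishes because it is stable under a scalar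
   other than 1.  Everything reduces to the dimensions k = 3 and k = 4.

   There, take a plane <s, t> with s^2 + s t + t^2 = 1, so that S = 1/D and
   a0 = D = s t (s + t), extended by preimages of (D g)^2 for g in G, where G
   has dimension k - 2 and S(G) = 1.  This requires Tr(g s) = Tr(g t) = 0 for
   all g in G.  The number of such (s, t) is governed by character sums over
   the conic, i.e. over the norm-one group of the quadratic extension.  Their
   fourth moment is at most 3 q^2 (q + 1)^2, and each value is repeated along
   an orbit of this group, which gives |f|^4 <= 2 q^3.  For k = 4 the plane G
   is taken in F_32: the sum then also repeats along five Frobenius
   conjugates, and |f|^4 <= 2 q^3 / 5 < (q / 16)^4 already for q = 2^15. *)

From HB Require Import structures.
Require Import Defs.
From mathcomp Require Import all_boot all_order all_algebra all_fingroup.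
From mathcomp Require Import all_solvable all_field.
From mathcomp Require Import ring zify.

Set Implicit Arguments.
Unset Strict Implicit.
Unset Printing Implicit Defensive.

Import Order.TTheory GRing.Theory Num.Theory.
Local Open Scope ring_scope.

(** * Subspace polynomials in characteristic two, computed along a basis *)

Section SubspacePolynomials.
Variable F : fieldType.
Hypothesis two_eq0 : 2%:R = 0 :> F.
Implicit Types (x y a w c : F) (s t : seq F).

Lemma addff x : x + x = 0.
Proof. by ring: two_eq0. Qed.

Lemma addf_eq0 x y : (x + y == 0) = (x == y).
Proof. by rewrite -{1}[y]opprK subr_eq0 -[- y]add0r -(addff y) addrK. Qed.

Lemma eq_of_addf0 x y : x + y = 0 -> x = y.
Proof. by move/eqP; rewrite addf_eq0 => /eqP. Qed.

Lemma sqrfD x y : (x + y) ^+ 2 = x ^+ 2 + y ^+ 2.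
Proof. by ring: two_eq0. Qed.

(* [spoly s] evaluates the subspace polynomial prod_(u in <<s>>) (X + u),
   [sprod s] is its coefficient of X, and [srecip s] is the sum of the
   reciprocals of the nonzero elements of <<s>>, when [s] is free. *)
Fixpoint spoly s x : F :=
  if s is w :: s' then spoly s' x * (spoly s' x + spoly s' w) else x.

Fixpoint sprod s : F :=
  if s is w :: s' then sprod s' * spoly s' w else 1.

Fixpoint srecip s : F :=
  if s is w :: s' then srecip s' + sprod s' / spoly s' w else 0.

Lemma spolyD s x y : spoly s (x + y) = spoly s x + spoly s y.
Proof. by elim: s => //= w s ->; ring: two_eq0. Qed.

Lemma spoly0 s : spoly s 0 = 0.
Proof. by elim: s => //= w s ->; rewrite mul0r. Qed.

Lemma spoly_cat s t x : spoly (t ++ s) x = spoly (map (spoly s) t) (spoly s x).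
Proof. by elim: t x => //= w t IHt x; rewrite !IHt. Qed.

Lemma sprod_cat s t : sprod (t ++ s) = sprod s * sprod (map (spoly s) t).
Proof.
elim: t => [|w t IHt] /=; first by rewrite mulr1.
by rewrite IHt spoly_cat mulrA.
Qed.

Lemma srecip_cat s t :
  srecip (t ++ s) = srecip s + sprod s * srecip (map (spoly s) t).
Proof.
elim: t => [|w t IHt] /=; first by rewrite mulr0 addr0.
by rewrite IHt spoly_cat sprod_cat mulrDr addrA !mulrA.
Qed.

Lemma spoly_scale c s x :
  spoly (map ( *%R c) s) (c * x) = c ^+ (2 ^ size s) * spoly s x.
Proof.
elim: s x => [|w s IHs] x /=; first by rewrite expr1.
by rewrite !IHs expnS mul2n -addnn exprD; ring.
Qed.

(** The coefficient of X scales by c^(2^m - 1) with m = [size s]; the extra factor c avoids a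
    subtraction in the exponent. *)
Lemma sprod_scale c s :
  c * sprod (map ( *%R c) s) = c ^+ (2 ^ size s) * sprod s.
Proof.
elim: s => [|w s IHs] /=; first by rewrite expr1.
by rewrite mulrA IHs spoly_scale expnS mul2n -addnn exprD; ring.
Qed.

Lemma srecip_scale c s : c != 0 ->
  srecip (map ( *%R c) s) = c^-1 * srecip s.
Proof.
move=> c0; elim: s => [|w s IHs] /=; first by rewrite mulr0.
rewrite IHs spoly_scale mulrDr; congr (_ + _).
apply: (mulfI c0); rewrite mulrA sprod_scale mulrA divff // mul1r.
by rewrite -mulf_div divff ?mul1r // expf_neq0.
Qed.

Lemma spoly_sqr s x :
  spoly (map (fun g => g ^+ 2) s) (x ^+ 2) = spoly s x ^+ 2.
Proof. by elim: s x => //= w s IHs x; rewrite !IHs exprMn sqrfD. Qed.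

Lemma sprod_sqr s : sprod (map (fun g => g ^+ 2) s) = sprod s ^+ 2.
Proof.
by elim: s => [|w s IHs] /=; rewrite ?expr1n // IHs spoly_sqr exprMn.
Qed.

Lemma srecip_sqr s : srecip (map (fun g => g ^+ 2) s) = srecip s ^+ 2.
Proof.
elim: s => [|w s IHs] /=; first by rewrite expr0n.
by rewrite IHs sprod_sqr spoly_sqr sqrfD exprMn exprVn.
Qed.

Lemma recip_pair (a l m : F) : l != 0 -> l + m != 0 ->
  a / l + a / (l + m) = a * m / (l * (l + m)).
Proof.
move=> l0 lm0; rewrite addf_div //; congr (_ / _).
by ring: two_eq0.
Qed.

Lemma srecip_plane (s t : F) : s ^+ 2 + s * t + t ^+ 2 = 1 ->
  s * t * (s + t) != 0 -> srecip [:: t; s] = (s * t * (s + t))^-1.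
Proof.
move=> n1; rewrite !mulf_eq0 !negb_or => /andP[/andP[s0 t0] st0] /=.
rewrite add0r !mul1r [t + s]addrC -[s^-1]div1r addf_div ?mulf_neq0 //.
by rewrite -[RHS]div1r -[in RHS]n1; congr (_ / _); ring.
Qed.

(* If g s and g t have trace zero, then (D g)^2 is a value of the subspace
   polynomial of the plane <s, t>, where D = s t (s + t). *)
Lemma spoly_plane (s t g p r : F) :
  g * s = p ^+ 2 + p -> g * t = r ^+ 2 + r ->
  spoly [:: t; s] (t * p + s * r) = (s * t * (s + t)) ^+ 2 * g ^+ 2.
Proof.
move=> gs gt /=; set x := t * p + s * r.
(* The two sides add up to s^2 (g t) + s t (g s), which is zero in characteristic two. *)
have xE : x * (x + s) = t * (t + s) * p ^+ 2.
  apply: eq_of_addf0.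
  transitivity (s ^+ 2 * (r ^+ 2 + r) + s * t * (p ^+ 2 + p)).
    by rewrite /x; ring: two_eq0.
  by rewrite -gs -gt; ring: two_eq0.
(* With u = t (t + s), one has u p^2 (u p^2 + u) = u^2 (p^2 + p)^2. *)
rewrite xE; transitivity ((t * (t + s)) ^+ 2 * (p ^+ 2 + p) ^+ 2).
  by move: (t * (t + s)) => u; apply: eq_of_addf0; ring: two_eq0.
by rewrite -gs; ring.
Qed.

(** This form serves twice: being anisotropic, it excludes vanishing planes, and for a plane with
    [srecip] equal to 1 it yields the relation assumed in [nrm_plane_neq1]. *)
Lemma srecip2_mul_sprod w v : sprod [:: w; v] != 0 ->
  srecip [:: w; v] * sprod [:: w; v] = w ^+ 2 + w * v + v ^+ 2.
Proof.
rewrite /= !mul1r add0r !mulf_eq0 !negb_or => /and3P[v0 w0 wv0].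
rewrite -[v^-1]div1r addf_div ?(mulf_neq0 w0 wv0) // divfK ?mulf_neq0 //.
by ring.
Qed.

Lemma addf_inv_sqr c : c != 0 -> c^-1 + c / c ^+ 2 = 0.
Proof. by move=> c0; rewrite expr2 invfM mulVKf ?addff. Qed.

Section NoCubeRoot.
Hypothesis sqrD1_neq1 : forall x : F, x ^+ 2 + x != 1.

(** Dividing by y^2 turns a nontrivial zero into a root of X^2 + X + 1, that is, a primitive cube
    root of unity. *)
Lemma conic_eq0 x y : (x ^+ 2 + x * y + y ^+ 2 == 0) = (x == 0) && (y == 0).
Proof.
have [->|y0] /= := eqVneq y 0.
  by rewrite mulr0 expr0n !addr0 expf_eq0 andbT.
rewrite andbF; apply: contraNF (sqrD1_neq1 (x / y)) => /eqP xy.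
apply/eqP/eq_of_addf0/(mulIf (expf_neq0 2 y0)).
rewrite mul0r -xy exprMn !mulrDl exprVn divfK ?expf_neq0 // mul1r.
by rewrite [y ^+ 2]expr2 mulrA divfK.
Qed.

Lemma srecip1_neq0 w : sprod [:: w] != 0 -> srecip [:: w] != 0.
Proof. by rewrite /= !mul1r add0r invr_eq0. Qed.

Lemma srecip2_neq0 w v : sprod [:: w; v] != 0 -> srecip [:: w; v] != 0.
Proof.
move=> wv; have [w0|w0] := eqVneq w 0.
  by move: wv; rewrite w0 /= mul0r mulr0 eqxx.
have : srecip [:: w; v] * sprod [:: w; v] != 0.
  by rewrite srecip2_mul_sprod // conic_eq0 (negPf w0).
by rewrite mulf_eq0 negb_or => /andP[].
Qed.

End NoCubeRoot.
End SubspacePolynomials.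

(** * Multipliers carrying given elements into a subspace *)

Section ColonSpace.
Variables (F0 : fieldType) (L : fieldExtType F0).
Implicit Types (w x : L) (s : seq L) (V : {vspace L}).

Lemma dimv_capS (vT : vectType F0) (U W : {vspace vT}) :
  (\dim U + \dim W <= \dim {:vT} + \dim (U :&: W))%N.
Proof. by rewrite -dimv_sum_cap leq_add2r dimvS ?subvf. Qed.

Definition colonv V s : {vspace L} := (\bigcap_(x <- s) (V * <[x^-1]>))%VS.

Lemma mem_colonv V s w : {in s, forall x, x != 0} ->
  (w \in colonv V s) = all (fun x => w * x \in V) s.
Proof.
rewrite /colonv; elim: s => [|x s IHs] nz; first by rewrite big_nil memvf.
have x0 : x != 0 by rewrite nz ?mem_head.
rewrite big_cons memv_cap /= IHs => [|y ys]; last by rewrite nz ?inE ?ys ?orbT.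
congr (_ && _); apply/memv_cosetP/idP => [[u uV ->]|wx]; first by rewrite divfK.
by exists (w * x); rewrite ?mulfK.
Qed.

(** Each condition w x in V confines w to V x^-1, of codimension at most d, and codimensions at most
    add up under intersection. *)
Lemma dim_colonv V s d : {in s, forall x, x != 0} ->
  (\dim {:L} <= \dim V + d)%N ->
  (\dim {:L} <= \dim (colonv V s) + d * size s)%N.
Proof.
have arith (n v w c m : nat) :
  (n <= v + d -> n <= w + d * m -> v + w <= n + c ->
  n <= c + d * m.+1)%N by rewrite mulnS; lia.
move=> nz dV; rewrite /colonv; elim: s nz => [|x s IHs] nz.
  by rewrite big_nil muln0 addn0.
have x0 : x != 0 by rewrite nz ?mem_head.
have := IHs (fun y ys => nz y (mem_behead (s := x :: s) ys)).
rewrite big_cons; move/(arith _ _ _ _ _ dV); apply.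
have xu : x^-1 \is a GRing.unit by rewrite unitfE invr_eq0.
by rewrite -(dim_cosetv_unit V xu); apply: dimv_capS.
Qed.
End ColonSpace.

(** * Free families over F_2, vanishing subspaces and their gluing *)

Section Spans.
Variable L : fieldExtType 'F_2.
Implicit Types (x y a w c : L) (s t : seq L) (V W : {vspace L}).

Lemma two_eq0_ext : 2%:R = 0 :> L.
Proof.
have h2 : 2%:R = 0 :> 'F_2 by apply/val_inj.
by rewrite -(rmorph_nat (in_alg L)) h2 rmorph0.
Qed.
Local Notation two_eq0 := two_eq0_ext.

Lemma F2_cases (c : 'F_2) : c = 0 \/ c = 1.
Proof. by case: c => [[|[|//]] i]; [left | right]; apply/val_inj. Qed.

Lemma mem_span_cons w s x :
  (x \in <<w :: s>>%VS) = (x \in <<s>>%VS) || (x + w \in <<s>>%VS).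
Proof.
rewrite span_cons; apply/memv_addP/orP => [[u /vlineP[c ->] [v vs ->]]|].
  case: (F2_cases c) => ->; rewrite ?scale0r ?scale1r ?add0r; first by left.
  by right; rewrite addrAC (addff two_eq0) add0r.
case=> xs; first by exists 0; [exact: mem0v | exists x; rewrite ?add0r].
exists w; first exact: memv_line.
by exists (x + w); rewrite // addrCA (addff two_eq0) addr0.
Qed.

Lemma spoly_eq0 s x : (spoly s x == 0) = (x \in <<s>>%VS).
Proof.
elim: s x => [|w s IHs] x; first by rewrite /= span_nil memv0.
by rewrite /= mulf_eq0 -(spolyD two_eq0) !IHs mem_span_cons.
Qed.

(** Each factor [spoly s' w] of [sprod] tests whether w lies outside the span of the entries after
    it; [sprod s] is the Moore determinant of s. *)
Lemma free_sprod s : free s = (sprod s != 0).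
Proof.
elim: s => [|w s IHs] /=; first by rewrite nil_free oner_eq0.
by rewrite free_cons mulf_eq0 negb_or IHs spoly_eq0 andbC.
Qed.

Lemma spoly_linear s : linear (spoly s).
Proof.
move=> c x y; rewrite (spolyD two_eq0); congr (_ + _).
by case: (F2_cases c) => ->; rewrite ?scale0r ?scale1r ?spoly0.
Qed.

HB.instance Definition _ s :=
  GRing.isLinear.Build 'F_2 L L *:%R (spoly s) (spoly_linear s).

Definition spoly_img s : {vspace L} := limg (linfun (spoly s)).

Lemma spoly_imgP s y : reflect (exists x, y = spoly s x) (y \in spoly_img s).
Proof.
apply: (iffP memv_imgP) => [[x _ ->]|[x ->]]; first by exists x; rewrite lfunE.
by exists x; rewrite ?memvf // lfunE.
Qed.

Lemma dim_spoly_img s : free s -> (size s + \dim (spoly_img s))%N = \dim {:L}.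
Proof.
move=> fs; rewrite -(limg_ker_dim (linfun (spoly s)) fullv) capfv.
congr (_ + _)%N; rewrite -(eqP fs); congr (\dim _).
by apply/vspaceP => x; rewrite memv_ker lfunE spoly_eq0.
Qed.

Definition vanishing k := exists s : seq L,
  [/\ size s = k, free s & srecip s = 0].

Lemma free_cat_img s t : free s -> free (map (spoly s) t) -> free (t ++ s).
Proof. by rewrite !free_sprod sprod_cat => ? ?; rewrite mulf_neq0. Qed.

Lemma lift_spoly_img s t : {in t, forall y, y \in spoly_img s} ->
  exists t', t = map (spoly s) t'.
Proof.
elim: t => [|y t IHt] tP; first by exists [::].
have [x ->] := spoly_imgP _ _ (tP y (mem_head _ _)).
have [t' ->] := IHt (fun z zt => tP z (mem_behead (s := y :: t) zt)).
by exists (x :: t').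
Qed.

(** The vectors added to s are preimages of t under [spoly s], and the equation assumed is
    [srecip_cat] read on their images. *)
Lemma vanishing_cat s t : free s -> free t ->
  srecip s + sprod s * srecip t = 0 ->
  {in t, forall y, y \in spoly_img s} -> vanishing (size t + size s).
Proof.
move=> fs ft r0 /lift_spoly_img[t' tE]; exists (t' ++ s).
rewrite size_cat tE size_map; split=> //; last by rewrite srecip_cat -tE.
by apply: free_cat_img; rewrite // -tE.
Qed.

Lemma free_scale c s : c != 0 -> free s -> free (map ( *%R c) s).
Proof.
move=> c0; rewrite !free_sprod => s0; apply: contraNneq s0 => sc0.
have := sprod_scale c s; rewrite sc0 mulr0 => /esym/eqP.
by rewrite mulf_eq0 expf_eq0 (negPf c0) andbF.
Qed.

(** Multiplying t by a nonzero c keeps its reciprocal sum zero, so it suffices that c carry t into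
    the image of [spoly s]. That image has codimension j, so such c form a space of codimension at
    most j k < n. *)
Lemma vanishing_add j k : (j * k < \dim {:L})%N ->
  vanishing j -> vanishing k -> vanishing (j + k).
Proof.
move=> jk [s [ss fs rs]] [t [st ft rt]].
have nzt : {in t, forall x, x != 0} by move=> x; apply: free_not0.
have /(dim_colonv nzt) : (\dim {:L} <= \dim (spoly_img s) + j)%N.
  by rewrite -(dim_spoly_img fs) ss addnC.
rewrite st => dW; have W0 : colonv (spoly_img s) t != 0%VS.
  by apply: contraTneq jk => W0; move: dW; rewrite W0 dimv0 -leqNgt.
have := memv_pick (colonv (spoly_img s) t).
have : vpick (colonv (spoly_img s) t) != 0.
  by rewrite vpick0.
move: (vpick _) => c c0; rewrite mem_colonv // => /allP cP.
have : srecip s + sprod s * srecip (map ( *%R c) t) = 0.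
  by rewrite rs srecip_scale // rt !mulr0 add0r.
move/(vanishing_cat fs (free_scale c0 ft)); rewrite size_map ss st addnC; apply.
by move=> _ /mapP[x xt ->]; apply: cP.
Qed.
End Spans.

(** * Subspaces stable under a subfield, and existence of subfields *)

Section ModuleSpaces.
Variables (F0 : fieldType) (L : fieldExtType F0).
Implicit Types (V W M : {vspace L}) (E : {subfield L}).

Lemma vbasis_neq0 V : {in (vbasis V : seq L), forall x, x != 0}.
Proof. by move=> x; apply: free_not0; apply: (basis_free (vbasisP V)). Qed.

Lemma mem_colonv_basis V W w :
  reflect {in W, forall e, w * e \in V} (w \in colonv V (vbasis W)).
Proof.
apply: (iffP idP) => [|wW]; rewrite mem_colonv; try exact: vbasis_neq0.
  move/allP=> wV e /(coord_vbasis) ->; rewrite mulr_sumr rpred_sum // => i _.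
  by rewrite -scalerAr rpredZ // wV // mem_nth // size_tuple.
by apply/allP => x /vbasis_mem/wW.
Qed.

Lemma colonv_module V E : (E * colonv V (vbasis E) <= colonv V (vbasis E))%VS.
Proof.
apply/prodvP => e w eE /mem_colonv_basis wE; apply/mem_colonv_basis => e' e'E.
by rewrite [e * w]mulrC -mulrA wE ?memvM.
Qed.

(** M grows by one line E x at a time, with x in W outside M. The line meets M only in 0, since e x
    in M with e nonzero would put x in M. *)
Lemma submodule_dim E W j :
  (E * W <= W)%VS -> (j * \dim E <= \dim W)%N ->
  exists M : {vspace L},
    [/\ (M <= W)%VS, (E * M <= M)%VS & \dim M = (j * \dim E)%N].
Proof.
move=> EW; elim: j => [|j IHj] dW.
  by exists 0%VS; rewrite sub0v prodv0 sub0v dimv0.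
have [|M [MW EM dM]] := IHj.
  by apply: leq_trans dW; rewrite leq_mul2r leqnSn orbT.
have /subvPn[x xW xM] : ~~ (W <= M)%VS.
  apply/negP => /dimvS; rewrite dM leqNgt (leq_trans _ dW) //.
  by rewrite ltn_mul2r adim_gt0 leqnn.
have x0 : x != 0 by apply: contraNneq xM => ->; exact: mem0v.
exists (M + E * <[x]>)%VS; split.
- rewrite subv_add MW (subv_trans _ EW) // prodvSr //.
- rewrite prodvDr subv_add (subv_trans EM (addvSl _ _)) /= prodvA.
  by rewrite (subv_trans _ (addvSr _ _)) // prodvSl // prodv_id.
rewrite dimv_disjoint_sum; last first.
  apply/eqP; rewrite -subv0; apply/subvP => y; rewrite memv_cap => /andP[yM].
  case/memv_cosetP => e eE yE; rewrite memv0 yE mulf_eq0 (negPf x0) orbF.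
  apply: contraNT xM => e0; rewrite -(mulKf e0 x) -yE (subvP EM) //.
  by rewrite memv_mul ?memvV.
by rewrite dM dim_cosetv_unit ?unitfE // mulSn addnC.
Qed.
End ModuleSpaces.

(** The Galois group is cyclic, generated by [alpha] of order n; the fixed field of its d-th power
    has degree d. *)
Lemma finField_subfield (F0 : finFieldType) (L : splittingFieldType F0) d :
  (d %| \dim {:L})%N -> exists E : {subfield L}, \dim E = d.
Proof.
move=> dn; have [alpha gen _] := finField_galois_generator (sub1v {:L}%AS).
have oa : #[alpha]%g = \dim {:L}.
  rewrite orderE -(eqP gen) -galois_dim ?dimv1 ?divn1 //.
  exact: finField_galois (sub1v _).
pose G := <[(alpha ^+ d)%g]>%G; pose E := (fixedField G)%AS; exists E.
have n0 : (0 < \dim {:L})%N by rewrite adim_gt0.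
have := dim_fixedField G; rewrite /= -orderE orderXdiv oa // => h.
have := divnK (field_dimS (subvf E)); rewrite -h => /eqP.
rewrite -[X in _ == X](divnK dn) eqn_pmul2l => [/eqP //|].
by rewrite divn_gt0 ?(dvdn_gt0 n0) // dvdn_leq.
Qed.

(** * Reciprocal sums over subspaces of F_{2^n}: duality and gluing *)

Section FiniteField.
Variable L : fieldExtType 'F_2.
Local Notation K := (finvect_type L).
Local Notation n := (\dim {:L}).
Implicit Types (x y a w c : K) (s t : seq K) (V W : {vspace K}).

Let two_eq0 : 2%:R = 0 :> K := two_eq0_ext K.

Lemma sum_span_cons w s (G : K -> K) : w \notin <<s>>%VS ->
  \sum_(u in <<w :: s>>%VS) G u =
  \sum_(u in <<s>>%VS) G u + \sum_(u in <<s>>%VS) G (w + u).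
Proof.
move=> ws; rewrite (bigID [in <<s>>%VS]) /=; congr (_ + _).
  apply: eq_bigl => u; rewrite mem_span_cons.
  by case: (u \in _); rewrite ?orbT ?andbF.
rewrite (reindex_inj (addrI w)) /=; apply: eq_bigl => u.
rewrite mem_span_cons addrAC (addff two_eq0) add0r.
case: (boolP (u \in _)) => us; last by rewrite orbF andbN.
by rewrite orbT /= rpredDr.
Qed.

(** Off the span, this is the logarithmic derivative of the subspace polynomial, whose derivative is
    the constant [sprod s]. On the span, the convention 0^-1 = 0 drops the zero term. *)
Lemma sum_recip_coset s a : free s ->
  \sum_(u in <<s>>%VS) (a + u)^-1 =
  if a \in <<s>>%VS then srecip s else sprod s / spoly s a.
Proof.
elim: s a => [|w s IHs] a.
  move=> _; rewrite (eq_bigl (pred1 0)) => [|u]; last by rewrite span_nil memv0.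
  rewrite big_pred1_eq addr0 /= span_nil memv0 div1r.
  by case: eqP => // ->; rewrite invr0.
rewrite free_cons => /andP[ws fs]; rewrite sum_span_cons //.
under [X in _ + X]eq_bigr do rewrite addrA.
rewrite !IHs // mem_span_cons /=.
have lD := spolyD two_eq0 s.
have [as_|as_] /= := boolP (a \in _).
  rewrite rpredDl // (negPf ws) lD.
  by move: as_; rewrite -spoly_eq0 => /eqP ->; rewrite add0r.
have [aws|aws] /= := boolP (a + w \in _).
  have /eqP -> : spoly s a == spoly s w.
    by rewrite -(addf_eq0 two_eq0) -lD spoly_eq0.
  by rewrite addrC.
move: as_ aws; rewrite -!spoly_eq0 lD => la law.
exact: recip_pair.
Qed.

Lemma sum_recip s : free s -> \sum_(u in <<s>>%VS) u^-1 = srecip s.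
Proof.
move=> fs; have := sum_recip_coset 0 fs; rewrite mem0v => <-.
by apply: eq_bigr => u _; rewrite add0r.
Qed.

(** Reindexing by v -> c v shows that the sum S satisfies c^-1 S = S. *)
Lemma sum_recip_stable V c : c != 0 -> c != 1 ->
  (forall v, v \in V -> c * v \in V) -> \sum_(u in V) u^-1 = 0.
Proof.
move=> c0 c1 cV; set S := \sum_(u in V) _.
have injc : {in V &, injective ( *%R c)} by move=> u v _ _; apply: mulfI.
have cVE : [set c * v | v in V] = [set v in V].
  apply/eqP; rewrite eqEcard; apply/andP; split.
    by apply/subsetP => _ /imsetP[v vV ->]; rewrite inE cV.
  by rewrite card_in_imset // cardsE.
have cS : c^-1 * S = S.
  rewrite {2}/S -(eq_bigl _ _ (fun u => in_set (mem V) u)) -cVE.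
  by rewrite big_imset //= mulr_sumr; apply: eq_bigr => v _; rewrite invfM.
apply/eqP; move/eqP: cS; rewrite -subr_eq0 -{2}[S]mul1r -mulrBl mulf_eq0.
case/orP => //; rewrite subr_eq0 => /eqP/(congr1 (@GRing.inv _)).
by rewrite invrK invr1 => /eqP; rewrite (negPf c1).
Qed.

Lemma card_ext : #|K| = (2 ^ n)%N.
Proof.
transitivity #|({:K}%VS : {vspace K})|; last by rewrite card_vspace card_Fp.
by apply: eq_card => x; rewrite memvf.
Qed.

Lemma vanishing_dual k : (1 < n)%N -> vanishing K k -> vanishing K (n - k).
Proof.
move=> n1 [s [ss fs rs]]; pose t := vbasis (<<s>>^C)%VS.
have fts : free (t ++ s).
  rewrite cat_free fs (basis_free (vbasisP _)) /=; apply/directv_addP.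
  by rewrite (span_basis (vbasisP _)) capvC capv_compl.
have full : <<t ++ s>>%VS = fullv.
  by rewrite span_cat (span_basis (vbasisP _)) addvC addv_complf.
(* Stability under such a scalar makes the sum over the whole field zero; it exists because 2^n >
   2. *)
have [c c01] : exists c : K, (c != 0) && (c != 1).
  apply/existsP; rewrite -[[exists _, _]]negbK negb_exists.
  apply/negP => /forallP h.
  have : (#|K| <= #|[set (0%R : K); (1%R : K)]|)%N.
    apply/subset_leq_card/subsetP => c _; rewrite !inE.
    by have := h c; rewrite negb_and !negbK.
  rewrite card_ext cards2 eq_sym oner_eq0 -[X in (_ <= X)%N]/(2 ^ 1)%N.
  by rewrite leq_exp2l // leqNgt n1.
case/andP: c01 => c0 c1.
have : \sum_(u in <<t ++ s>>%VS) u^-1 = 0.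
  by apply: (sum_recip_stable c0 c1) => v _; rewrite full memvf.
rewrite sum_recip // srecip_cat rs add0r => /eqP.
move: (fts); rewrite free_sprod sprod_cat !mulf_eq0 negb_or.
case/andP=> /negPf-> pt /= /eqP rt.
exists (map (spoly s) t); rewrite free_sprod pt rt; split=> //.
by rewrite size_map size_tuple dimv_compl (eqP fs) ss.
Qed.

(** The w with w E inside the image of [spoly s] form an E-space of dimension at least n - k dim E.
    An E-subspace M of E-dimension j in it has reciprocal sum zero, being stable under an element of
    E outside F_2. *)
Lemma vanishing_add_module (E : {subfield K}) k j : (1 < \dim E)%N ->
  vanishing K k -> ((k + j) * \dim E <= n)%N -> vanishing K (k + j * \dim E).
Proof.
move=> E1 [s [ss fs rs]] kj.
have /(dim_colonv (@vbasis_neq0 _ _ E)) :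
    (\dim {:K} <= \dim (spoly_img s) + k)%N.
  by rewrite -(dim_spoly_img fs) ss addnC.
rewrite size_tuple => dW.
have jW : (j * \dim E <= \dim (colonv (spoly_img s) (vbasis E)))%N.
  by rewrite -(leq_add2r (k * \dim E)) (leq_trans _ dW) // -mulnDl addnC.
have [M [MW EM dM]] := submodule_dim (colonv_module _ _) jW.
have [c cE c01] : exists2 c, c \in E & c \notin 1%VS.
  by apply/subvPn; apply: contraL E1 => /dimvS; rewrite dimv1 -leqNgt.
have c0 : c != 0 by apply: contraNneq c01 => ->; apply: mem0v.
have c1 : c != 1 by apply: contraNneq c01 => ->; apply: mem1v.
have cM v : v \in M -> c * v \in M by move=> vM; rewrite (subvP EM) // memv_mul.
have fM : free (vbasis M) := basis_free (vbasisP M).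
have rM : srecip (vbasis M) = 0.
  by rewrite -sum_recip // (span_basis (vbasisP M)) (sum_recip_stable c0 c1).
have r0 : srecip s + sprod s * srecip (vbasis M) = 0.
  by rewrite rs rM mulr0 add0r.
rewrite -dM -ss addnC -(size_tuple (vbasis M)); apply: vanishing_cat => //.
(* Taking the multiplier 1 in E, M itself lies in the image of [spoly s]. *)
move=> y /vbasis_mem /(subvP MW)/mem_colonv_basis/(_ 1).
by rewrite mulr1; apply; apply: mem1v.
Qed.
End FiniteField.

(** * No primitive cube root of unity in odd degree *)

Section OddDegree.
Variable L : fieldExtType 'F_2.
Local Notation K := (finvect_type L).
Local Notation n := (\dim {:L}).
Hypothesis n_odd : odd n.
Implicit Types (x y z : K).

Let two_eq0 : 2%:R = 0 :> K := two_eq0_ext K.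

(** A root would satisfy x^2 = x + 1 and x^4 = x, so an odd number n of squarings would send x to x
    + 1, against x^(2^n) = x. *)
Lemma sqrD1_neq1 x : x ^+ 2 + x != 1.
Proof.
apply/eqP => x2; have x2E : x ^+ 2 = x + 1.
  by apply: (eq_of_addf0 two_eq0); rewrite addrA x2 addff.
have x4 : x ^+ (2 ^ 2) = x.
  rewrite (_ : 2 ^ 2 = 2 * 2)%N // exprM x2E sqrfD // x2E expr1n.
  rewrite -addrA addff //.
  by rewrite addr0.
have xk k : x ^+ (2 ^ (2 * k)) = x.
  by elim: k => [|k IHk]; rewrite ?expr1 // mulnS expnD exprM x4.
have := expf_card x; rewrite card_ext -[X in (2 ^ X)%N]odd_double_half.
rewrite n_odd -mul2n.
rewrite expnD exprM x2E.
have powD k : (x + 1) ^+ (2 ^ k) = x ^+ (2 ^ k) + 1.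
  elim: k => [|k IHk]; rewrite ?expr1 // expnS mulnC exprM IHk sqrfD //.
  by rewrite -exprM mulnC -expnS expr1n.
rewrite powD xk => /eqP; rewrite -subr_eq0 addrAC subrr add0r.
by rewrite oner_eq0.
Qed.

End OddDegree.

(** * Translation of [calK] into vanishing subspaces *)

Section SumFree.
Variable L : fieldExtType 'F_2.
Local Notation K := (finvect_type L).
Local Notation n := (\dim {:L}).

Lemma sum_f_inv_affine (V : {vspace K}) (a : K) :
  \sum_(x in [set a + v | v in V]) f_inv x =
  if a \in V then srecip (vbasis V) else sprod (vbasis V) / spoly (vbasis V) a.
Proof.
have fV : free (vbasis V) := basis_free (vbasisP V).
rewrite big_imset /=; last by move=> u v _ _; apply: addrI.
have := sum_recip_coset a fV; rewrite (span_basis (vbasisP V)) => <-.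
by apply: eq_bigr => u _; rewrite /f_inv; case: eqP => // ->; rewrite invr0.
Qed.

(** Finiteness makes [vanishing] decidable, which lets [calK_vanishing] extract a subspace from a
    negated universal statement. *)
Lemma vanishingP k : reflect (vanishing K k)
  [exists s : k.-tuple K, free s && (srecip s == 0)].
Proof.
apply: (iffP existsP) => [[s /andP[fs /eqP rs]]|[s [ss fs rs]]].
  by exists s; rewrite size_tuple.
by exists (Tuple (introT eqP ss)); rewrite fs rs eqxx.
Qed.

Lemma calK_vanishing k : calK L k <-> (1 <= k <= n.-1)%N /\ vanishing K k.
Proof.
split=> [[kn nsf]|[kn [s [ss fs rs]]]]; split=> //.
  apply/vanishingP; apply: contraT => /vanishingP nv; case: nsf => A.
  case=> a [V [dV ->]]; rewrite sum_f_inv_affine.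
  have fV : free (vbasis V) := basis_free (vbasisP V).
  case: ifPn => aV.
    by move=> rV; apply: nv; exists (vbasis V); rewrite size_tuple.
  apply/eqP; rewrite mulf_neq0 ?invr_eq0 -?free_sprod //.
  by rewrite spoly_eq0 (span_basis (vbasisP V)).
move=> sf; apply: (sf [set 0 + v | v in <<s>>%VS]).
  by exists 0, <<s>>%VS; rewrite (eqP fs).
rewrite sum_f_inv_affine mem0v -sum_recip ?(basis_free (vbasisP _)) //.
by rewrite (span_basis (vbasisP _)) sum_recip.
Qed.
End SumFree.

(** * Geometry of the conic of norm-one pairs *)

Section Conic.
Variable F : fieldType.
Hypothesis two_eq0 : 2%:R = 0 :> F.
Hypothesis sqrD1_neq1 : forall x : F, x ^+ 2 + x != 1.
Implicit Types k y z : F * F.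

Let four_eq0 : 4%:R = 0 :> F.
Proof. by rewrite (natrM _ 2 2) two_eq0 mul0r. Qed.

Let six_eq0 : 6%:R = 0 :> F.
Proof. by rewrite (natrM _ 2 3) two_eq0 mul0r. Qed.

(* Pairs encode the quadratic extension F(omega), omega^2 = omega + 1, on the
   basis 1, omega: [cmul] is its product and [nrm] its norm. *)
Definition nrm y : F := y.1 ^+ 2 + y.1 * y.2 + y.2 ^+ 2.
Definition cmul y z : F * F :=
  (y.1 * z.1 + y.2 * z.2, y.1 * z.2 + y.2 * z.1 + y.2 * z.2).
(** This is the first coordinate of [cmul y z], whence multiplication is self-adjoint for it. *)
Definition dot y z : F := y.1 * z.1 + y.2 * z.2.
(** The Frobenius of F extended by fixing omega, as opposed to squaring in F(omega). *)
Definition csqr y : F * F := (y.1 ^+ 2, y.2 ^+ 2).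

Lemma nrm_eq0 y : (nrm y == 0) = (y == 0).
Proof. by rewrite /nrm conic_eq0 //; case: y. Qed.

Lemma nrm_cmul y z : nrm (cmul y z) = nrm y * nrm z.
Proof.
case: y z => [a b] [c d]; rewrite /nrm /=; apply: (eq_of_addf0 two_eq0).
by ring: two_eq0 four_eq0 six_eq0.
Qed.

Lemma nrm_csqr y : nrm (csqr y) = nrm y ^+ 2.
Proof.
case: y => a b; rewrite /nrm /=; apply: (eq_of_addf0 two_eq0).
by ring: two_eq0 four_eq0 six_eq0.
Qed.

Lemma nrm_scale (c : F) y : nrm (c * y.1, c * y.2) = c ^+ 2 * nrm y.
Proof. by rewrite /nrm /=; ring. Qed.

Lemma dot_cmul k y z : dot (cmul k y) z = dot k (cmul y z).
Proof. by rewrite /dot /=; ring. Qed.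

Lemma dot_csqr k y : dot (csqr k) (csqr y) = dot k y ^+ 2.
Proof. by rewrite /dot /= (sqrfD two_eq0) !exprMn. Qed.

Lemma dotDr k y z : dot k (y + z) = dot k y + dot k z.
Proof. by rewrite /dot /=; ring. Qed.

Lemma cmulDr k y z : cmul k (y + z) = cmul k y + cmul k z.
Proof. by congr pair; rewrite /=; ring. Qed.

Lemma pair_addf y : y + y = 0.
Proof. by congr pair; rewrite /= addff. Qed.

Lemma pair_addf_eq0 y z : (y + z == 0) = (y == z).
Proof.
apply/eqP/eqP => [yz|->]; last exact: pair_addf.
by rewrite -[LHS]addr0 -(pair_addf z) addrA yz add0r.
Qed.

Lemma cmul_inj k : k != 0 -> injective (cmul k).
Proof.
move=> k0 y z /eqP; rewrite -pair_addf_eq0 -cmulDr -nrm_eq0 nrm_cmul mulf_eq0.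
by rewrite !nrm_eq0 (negPf k0) /= pair_addf_eq0 => /eqP.
Qed.

Lemma csqr_inj : injective csqr.
Proof.
case=> [a b] [c d] [] /eqP ac /eqP bd; move: ac bd.
rewrite -2!(addf_eq0 two_eq0) -!(sqrfD two_eq0) !expf_eq0 /=.
rewrite !(addf_eq0 two_eq0).
by move=> /eqP-> /eqP->.
Qed.

(** The alternating form attached to [nrm]; as a 2 x 2 determinant, it vanishes exactly on
    proportional pairs. *)
Definition polar y z : F := y.1 * z.2 + y.2 * z.1.

Lemma nrmD y z : nrm (y + z) = nrm y + nrm z + polar y z.
Proof.
case: y z => [a b] [c d]; rewrite /nrm /polar /=; apply: (eq_of_addf0 two_eq0).
by ring: two_eq0 four_eq0 six_eq0.
Qed.

Lemma polarDr y z k : polar y (z + k) = polar y z + polar y k.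
Proof. by rewrite /polar /=; ring. Qed.

Lemma polar_eq0 y z : z != 0 -> polar y z = 0 ->
  exists c, y = (c * z.1, c * z.2).
Proof.
case: y z => [a b] [c d]; rewrite /polar /= => z0 /(eq_of_addf0 two_eq0) ad.
have [c0|c0] := eqVneq c 0.
  have d0 : d != 0 by apply: contraNneq z0 => ->; rewrite c0.
  move/eqP: ad; rewrite c0 mulr0 mulf_eq0 (negPf d0) orbF => /eqP->.
  by exists (b / d); rewrite mulr0 divfK.
by exists (a / c); rewrite divfK // mulrAC ad mulfK.
Qed.

Lemma nrm_chord y z : nrm y = 1 -> nrm (y + z) = 1 -> nrm z = polar y z.
Proof.
move=> n1; rewrite nrmD n1 => nz; apply: (eq_of_addf0 two_eq0).
by rewrite -[RHS](subrr 1) -{1}nz; ring.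
Qed.

(* A line meets the conic in at most two points. *)
Lemma conic_chord y p r : nrm y = 1 -> nrm (y + p) = 1 -> nrm (y + r) = 1 ->
  p != 0 -> r != 0 -> polar p r = 0 -> p = r.
Proof.
move=> n1 /(nrm_chord n1) np /(nrm_chord n1) nr p0 r0 /(polar_eq0 r0)[c pE].
have polZ : polar y p = c * polar y r by rewrite pE /polar /=; ring.
move: np; rewrite polZ -nr pE nrm_scale expr2 -mulrA.
have c0 : c != 0 by apply: contraNneq p0 => c0; rewrite pE c0 !mul0r.
have Nr : nrm r != 0 by rewrite nrm_eq0.
move/(mulfI c0); rewrite -[RHS]mul1r => /(mulIf Nr) ->.
by rewrite !mul1r; case: (r).
Qed.

(** Otherwise y1 = y3 + p, y2 = y3 + r and y4 = y3 + p + r with p, r nonzero. All four norms being 1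
    forces [polar p r] = 0, and [conic_chord] gives p = r. *)
Lemma conic_energy (y1 y2 y3 y4 : F * F) :
  nrm y1 = 1 -> nrm y2 = 1 -> nrm y3 = 1 -> nrm y4 = 1 ->
  y1 + y2 + (y3 + y4) = 0 ->
  [\/ y1 = y2 /\ y3 = y4, y1 = y3 /\ y2 = y4 | y1 = y4 /\ y2 = y3].
Proof.
move=> n1 n2 n3 n4 s0.
have [y12|y12] := eqVneq y1 y2.
  constructor 1; split=> //; apply/eqP.
  by rewrite -pair_addf_eq0 -s0 y12 pair_addf add0r.
have [y13|y13] := eqVneq y1 y3.
  constructor 2; split=> //; apply/eqP.
  by rewrite -pair_addf_eq0 -s0 addrACA y13 pair_addf add0r.
have [y23|y23] := eqVneq y2 y3.
  constructor 3; split=> //; apply/eqP.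
  by rewrite -pair_addf_eq0 -s0 y23 addrA -[y1 + y3 + y3]addrA pair_addf addr0.
case/eqP: y12; have chord z : z = y3 + (z + y3).
  by rewrite addrCA pair_addf addr0.
rewrite (chord y1) (chord y2); congr (_ + _).
have y12E : (y1 + y3) + (y2 + y3) = y1 + y2 by rewrite addrACA pair_addf addr0.
have y4E : y4 = y3 + ((y1 + y3) + (y2 + y3)).
  apply/eqP; rewrite -pair_addf_eq0 y12E -s0 addrA.
  by rewrite [X in _ == X]addrC [y3 + y4]addrC.
apply: (@conic_chord y3); rewrite -?chord ?pair_addf_eq0 //.
rewrite (chord y1) in n1; rewrite (chord y2) in n2; rewrite y4E in n4.
have := nrm_chord n3 n4; rewrite nrmD (polarDr y3).
rewrite -(nrm_chord n3 n1) -(nrm_chord n3 n2) => h.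
by apply: (addrI (nrm (y1 + y3) + nrm (y2 + y3))); rewrite h addr0.
Qed.

End Conic.

(** * Character sums over the conic *)

Section ConicSums.
Variable F : finFieldType.
Hypothesis two_eq0 : 2%:R = 0 :> F.
Hypothesis sqrD1_neq1 : forall x : F, x ^+ 2 + x != 1.
Local Notation q := #|F|.
Implicit Types (x y c : F) (k z : F * F).

(** The Artin-Schreier image is the kernel of the absolute trace, so that [chi] is the character
    (-1)^Tr. *)
Definition as_img : {set F} := [set w ^+ 2 + w | w : F].

Definition chi x : int := if x \in as_img then 1 else -1.

Lemma as_imgP x : reflect (exists w, x = w ^+ 2 + w) (x \in as_img).
Proof. by apply: (iffP imsetP) => [[w _ ->]|[w ->]]; exists w. Qed.

Lemma as_imgD x y : x \in as_img -> y \in as_img -> x + y \in as_img.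
Proof.
move=> /as_imgP[v ->] /as_imgP[w ->]; apply/as_imgP; exists (v + w).
by rewrite (sqrfD two_eq0) addrACA.
Qed.

Lemma card_as_img : (#|as_img| * 2)%N = q.
Proof.
rewrite -[RHS]sum1_card (partition_big (fun w => w ^+ 2 + w) [in as_img]) /=.
  rewrite -sum_nat_const; apply: eq_bigr => z /as_imgP[v ->].
  have v1 : v != v + 1 by rewrite -subr_eq0 opprD addNKr oppr_eq0 oner_eq0.
  rewrite sum1_card -[LHS](_ : #|[set v; v + 1]| = 2%N); last first.
    by rewrite cards2 v1.
  apply: eq_card => w; rewrite !inE /=.
  have eqE (a b : F) : (a == b) = (a + b == 0) by rewrite addf_eq0.
  rewrite [RHS](_ : _ = (w ^+ 2 + w == v ^+ 2 + v)) //.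
  rewrite [w == v]eqE [w == v + 1]eqE [_ == v ^+ 2 + v]eqE -mulf_eq0.
  by congr (_ == 0); rewrite addrACA -(sqrfD two_eq0); ring.
by move=> w _; apply/as_imgP; exists w.
Qed.

(** Otherwise y avoids both [as_img] and its translate by x, which are disjoint of size q / 2 each
    and so fill F. *)
Lemma as_img_index2 x y :
  x \notin as_img -> y \notin as_img -> x + y \in as_img.
Proof.
move=> xH yH; apply: contraT => xyH.
have : (#|as_img :|: [set (x + h)%R | h in as_img]| < q)%N.
  rewrite -cardsT; apply: proper_card; apply/properP.
  split; first exact: subsetT.
  exists y; rewrite ?inE // (negPf yH) /=.
  apply: contra xyH => /imsetP[h hH ->].
  by rewrite addrA addff // add0r.
rewrite cardsU (card_imset _ (addrI x)).
rewrite (_ : _ :&: _ = set0).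
  by rewrite cards0 subn0 addnn -muln2 card_as_img ltnn.
apply/setP => z; rewrite !inE; apply/negP => /andP[zH /imsetP[h hH zE]].
case/negP: xH; rewrite -[x](addrK h) -zE.
by rewrite (eq_of_addf0 two_eq0 (addNr h)) as_imgD.
Qed.

Lemma chiD x y : chi (x + y) = chi x * chi y.
Proof.
have HD x' y' : x' \in as_img -> (x' + y' \in as_img) = (y' \in as_img).
  move=> x'H; apply/idP/idP => [|/(as_imgD x'H)//].
  by move/(as_imgD x'H); rewrite addrA addff // add0r.
rewrite /chi; case: (boolP (x \in as_img)) => xH; first by rewrite HD // mul1r.
case: (boolP (y \in as_img)) => yH; last by rewrite as_img_index2.
by rewrite addrC HD // (negPf xH).
Qed.

Lemma chi_sqr x : chi (x ^+ 2) = chi x.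
Proof.
have : chi (x ^+ 2 + x) = 1 by rewrite /chi ifT //; apply/as_imgP; exists x.
by rewrite chiD /chi; do 2 case: ifP.
Qed.
Lemma chi0 : chi 0 = 1.
Proof.
by rewrite /chi ifT //; apply/as_imgP; exists 0; rewrite expr0n addr0.
Qed.

Lemma sum_chi_mul c : \sum_x chi (x * c) = if c == 0 then q%:Z else 0.
Proof.
case: eqVneq => [->|c0].
  by under eq_bigr do rewrite mulr0 chi0; rewrite sumr_const natz.
have [v vH] : exists v : F, v \notin as_img.
  apply/existsP; rewrite -[[exists _, _]]negbK negb_exists.
  apply/negP => /forallP h.
  have : (q <= #|as_img|)%N.
    rewrite -cardsT subset_leq_card //; apply/subsetP => v _.
    by have := h v; rewrite negbK.
  rewrite -card_as_img -{2}[#|as_img|]muln1 leq_pmul2l //.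
  by apply/card_gt0P; exists 0; apply/as_imgP; exists 0; rewrite expr0n addr0.
(* Translation by v / c multiplies each term by [chi v] = -1. *)
set S := \sum_x _; have : S = - S.
  rewrite {1}/S (reindex_inj (addrI (v / c))) /= -mulN1r mulr_sumr.
  by apply: eq_bigr => x _; rewrite mulrDl divfK // chiD {1}/chi (negPf vH).
by move: S => S; lia.
Qed.

Lemma sum_chi_dot z : \sum_k chi (dot k z) = if z == 0 then (q ^ 2)%:Z else 0.
Proof.
rewrite -(pair_bigA _ (fun a b => chi (dot (a, b) z))) /=.
under eq_bigr => a _ do under eq_bigr => b _ do rewrite /dot chiD /=.
under eq_bigr => a _ do rewrite -mulr_sumr.
rewrite -mulr_suml !sum_chi_mul -[z == 0]/((z.1 == 0) && (z.2 == 0)).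
by do 2 case: eqP => _; rewrite /= ?mulr0 ?mul0r // -mulnn PoszM.
Qed.

Definition conic : {set F * F} := [set z | nrm z == 1].

Lemma sqrf_surj x : exists y, y ^+ 2 = x.
Proof.
have injs : injective (fun y : F => y ^+ 2).
  move=> a b /eqP; rewrite -(addf_eq0 two_eq0) -(sqrfD two_eq0) expf_eq0 /=.
  by rewrite addf_eq0 // => /eqP.
by exists (invF injs x); rewrite (f_invF injs).
Qed.

(** Scaling maps pairs of a nonzero scalar and a conic point bijectively onto the nonzero pairs,
    every norm being a square; and q^2 - 1 = (q - 1)(q + 1). *)
Lemma card_conic : #|conic| = q.+1.
Proof.
have q1 : (1 < q)%N by apply: finNzRing_gt1.
pose f (p : F * (F * F)) := (p.1 * p.2.1, p.1 * p.2.2).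
have nf p : nrm (f p) = p.1 ^+ 2 * nrm p.2 by rewrite nrm_scale.
have finj : {in setX [set~ 0] conic &, injective f}.
  move=> [a y] [b z]; rewrite !inE /= => /andP[a0 /eqP ny] /andP[b0 /eqP nz] fE.
  have ab : a = b.
    have := congr1 (@nrm F) fE; rewrite !nf /= ny nz !mulr1 => /eqP.
    rewrite -(addf_eq0 two_eq0) -(sqrfD two_eq0) expf_eq0 /=.
    by rewrite addf_eq0 // => /eqP.
  move: fE; rewrite ab /f /=; case=> /(mulfI b0) e1 /(mulfI b0) e2.
  by case: y z e1 e2 {ny nz} => [? ?] [? ?] /= -> ->.
have fim : f @: setX [set~ 0] conic = [set~ (0 : F * F)].
  apply/setP => y; rewrite !inE; apply/imsetP/idP => [[p]|y0].
    rewrite !inE => /andP[p0 /eqP np] ->.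
    rewrite -(nrm_eq0 two_eq0 sqrD1_neq1) nf np mulr1.
    by rewrite expf_eq0.
  have ny0 : nrm y != 0 by rewrite nrm_eq0.
  have [c cE] := sqrf_surj (nrm y).
  have c0 : c != 0 by apply: contraNneq ny0 => c0; rewrite -cE c0 expr0n.
  exists (c, (c^-1 * y.1, c^-1 * y.2)).
    by rewrite !inE c0 /= nrm_scale exprVn cE mulVf.
  by case: y {ny0 cE y0} => a b; rewrite /f /= !mulVKf.
have := card_in_imset finj; rewrite fim cardsX !cardsC1 card_prod.
have -> : (q * q).-1 = (q.-1 * q.+1)%N by case: q q1 => // m _; lia.
by move/eqP; rewrite eqn_pmul2l => [/eqP//|]; case: q q1.
Qed.

Definition conic_sum k : int := \sum_(z in conic) chi (dot k z).

Lemma conic_sum0 : conic_sum 0 = q.+1%:Z.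
Proof.
rewrite /conic_sum (eq_bigr (fun=> 1)) => [|z _].
  by rewrite sumr_const card_conic natz.
by rewrite /dot /= !mul0r addr0 chi0.
Qed.

Lemma conic_sum_cmul k z : z \in conic -> conic_sum (cmul k z) = conic_sum k.
Proof.
rewrite inE => /eqP nz.
have z0 : z != 0 by rewrite -(nrm_eq0 two_eq0 sqrD1_neq1) nz oner_eq0.
rewrite /conic_sum [RHS](reindex_inj (cmul_inj two_eq0 sqrD1_neq1 z0)) /=.
apply: eq_big => [y|y _]; first by rewrite !inE (nrm_cmul two_eq0) nz mul1r.
by rewrite dot_cmul.
Qed.

Lemma conic_sum_csqr k : conic_sum (csqr k) = conic_sum k.
Proof.
rewrite /conic_sum (reindex_inj (csqr_inj two_eq0)) /=.
apply: eq_big => [y|y _]; last by rewrite (dot_csqr two_eq0) chi_sqr.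
rewrite !inE (nrm_csqr two_eq0) sqrf_eq1.
by rewrite (eq_of_addf0 two_eq0 (addNr 1)) orbb.
Qed.

Definition conic_quads : {set ((F * F) * (F * F)) * ((F * F) * (F * F))} :=
  [set Y in setX (setX conic conic) (setX conic conic)
     | Y.1.1 + Y.1.2 + (Y.2.1 + Y.2.2) == 0].

(** Expand the power into a sum over quadruples of conic points; orthogonality in k keeps those with
    sum zero. *)
Lemma fourth_moment : \sum_k conic_sum k ^+ 4 = (q ^ 2 * #|conic_quads|)%:Z.
Proof.
pose U2 := setX conic conic.
have S2 k : conic_sum k ^+ 2 = \sum_(Y in U2) chi (dot k (Y.1 + Y.2)).
  rewrite expr2 /conic_sum big_distrlr pair_big /=.
  by apply: eq_big => [Y|Y _]; rewrite ?inE // -chiD -dotDr.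
have S4 k : conic_sum k ^+ 4 =
    \sum_(Y in setX U2 U2) chi (dot k (Y.1.1 + Y.1.2 + (Y.2.1 + Y.2.2))).
  rewrite (exprM _ 2 2) S2 expr2 big_distrlr pair_big /=.
  apply: eq_big => [Y|Y _]; first by rewrite [in RHS]inE.
  by rewrite -chiD -dotDr.
under eq_bigr do rewrite S4.
rewrite exchange_big /=; under eq_bigr do rewrite sum_chi_dot.
rewrite -big_mkcondr /= sumr_const -mulr_natr natz -PoszM; congr (Posz (_ * _)).
by apply: eq_card => Y; rewrite [RHS]inE.
Qed.

(** [conic_energy] leaves three pairings, each parametrized by two conic points. *)
Lemma card_conic_quads : (#|conic_quads| <= 3 * q.+1 ^ 2)%N.
Proof.
pose U2 := setX conic conic.
pose A1 := [set ((Y.1, Y.1), (Y.2, Y.2)) | Y in U2].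
pose A2 := [set ((Y.1, Y.2), (Y.1, Y.2)) | Y in U2].
pose A3 := [set ((Y.1, Y.2), (Y.2, Y.1)) | Y in U2].
have cU2 : #|U2| = (q.+1 ^ 2)%N by rewrite cardsX card_conic mulnn.
have sub : conic_quads \subset A1 :|: (A2 :|: A3).
  apply/subsetP => -[[y1 y2] [y3 y4]]; rewrite !inE /=.
  case/andP=> /andP[/andP[n1 n2] /andP[n3 n4]] /eqP s0.
  have [] := conic_energy two_eq0 sqrD1_neq1
    (eqP n1) (eqP n2) (eqP n3) (eqP n4) s0.
  - by case=> e e'; apply/orP; left; apply/imsetP; exists (y1, y3);
      rewrite ?inE ?n1 //= -e -e'.
  - by case=> e e'; apply/orP; right; apply/orP; left; apply/imsetP;
      exists (y1, y2); rewrite ?inE ?n1 //= e e'.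
  - by case=> e e'; apply/orP; right; apply/orP; right; apply/imsetP;
      exists (y1, y2); rewrite ?inE ?n1 //= e e'.
apply: leq_trans (subset_leq_card sub) _.
apply: leq_trans (leq_card_setU _ _) _.
rewrite mulSn leq_add //; first by rewrite -cU2 leq_imset_card.
apply: leq_trans (leq_card_setU _ _) _.
by rewrite mulSn mul1n leq_add // -cU2 leq_imset_card.
Qed.

Lemma nrm_iter_csqr k i : nrm (iter i (@csqr F) k) = nrm k ^+ (2 ^ i).
Proof.
elim: i => [|i IHi]; first by rewrite expr1.
by rewrite iterS (nrm_csqr two_eq0) IHi -exprM expnS mulnC.
Qed.

Lemma conic_sum_iter_csqr k i : conic_sum (iter i (@csqr F) k) = conic_sum k.
Proof. by elim: i => //= i IHi; rewrite conic_sum_csqr. Qed.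

(* The sum is constant on the orbits of k under multiplication by the conic
   and under Frobenius, so its fourth power occurs r (q + 1) times in the
   fourth moment. *)
Lemma conic_sum_bound k r : k != 0 ->
  injective (fun i : 'I_r => nrm k ^+ (2 ^ i)) ->
  r%:Z * conic_sum k ^+ 4 <= 2 * q%:Z ^+ 3.
Proof.
move=> k0 injN; pose f (p : 'I_r * (F * F)) := cmul (iter p.1 (@csqr F) k) p.2.
have nk0 : nrm k != 0 by rewrite nrm_eq0.
have nf p : p.2 \in conic -> nrm (f p) = nrm k ^+ (2 ^ p.1).
  by rewrite inE => /eqP np; rewrite nrm_cmul // np mulr1 nrm_iter_csqr.
have it0 (i : nat) : iter i (@csqr F) k != 0.
  by rewrite -(nrm_eq0 two_eq0 sqrD1_neq1) nrm_iter_csqr expf_neq0.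
have finj : {in setX [set: 'I_r] conic &, injective f}.
  move=> [i y] [j z]; rewrite !inE /= => ny nz fE.
  have ij : i = j by apply: injN; rewrite /= -(nf (i, y)) ?fE ?nf // inE.
  congr pair => //; move: fE; rewrite /f ij /=.
  exact: (cmul_inj two_eq0 sqrD1_neq1 (it0 j)).
pose O := f @: setX [set: 'I_r] conic.
have cO : #|O| = (r * q.+1)%N.
  by rewrite card_in_imset // cardsX cardsT card_ord card_conic.
have O0 : 0 \notin O.
  apply/imsetP => -[p]; rewrite inE => /andP[_ pc] p0.
  have : nrm (f p) != 0 by rewrite nf // expf_neq0.
  by rewrite -p0 nrm_eq0 // eqxx.
have sO : \sum_(k' in O) conic_sum k' ^+ 4 = (r * q.+1)%:Z * conic_sum k ^+ 4.
  rewrite (eq_bigr (fun=> conic_sum k ^+ 4)) => [|k' /imsetP[p]].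
    by rewrite sumr_const cO -[Posz _]natz mulr_natl.
  rewrite inE => /andP[_ pc] ->.
  by rewrite conic_sum_cmul // conic_sum_iter_csqr.
have := fourth_moment.
(* The moment splits into the orbit, the term (q + 1)^4 at k = 0, and a nonnegative rest. *)
rewrite (bigID [in O]) /= sO (bigD1 (0 : F * F)) //= conic_sum0.
have : 0 <= \sum_(i | (i \notin O) && (i != 0)) conic_sum i ^+ 4.
  by apply: sumr_ge0 => i _; apply: exprn_even_ge0.
move: (\sum_(_ | _) _) => rest rest0 mom.
have := card_conic_quads; move: #|conic_quads| mom => c mom cq.
have {}mom : r%:Z * q.+1%:Z * conic_sum k ^+ 4 + q.+1%:Z ^+ 4 <=
    q%:Z ^+ 2 * (3 * q.+1%:Z ^+ 2).
  apply: (@le_trans _ _ (q ^ 2 * c)%:Z).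
    by rewrite -mom PoszM lerD2l lerDl.
  have -> : q%:Z ^+ 2 * (3 * q.+1%:Z ^+ 2) = (q ^ 2 * (3 * q.+1 ^ 2))%:Z.
    by rewrite -!mulnn !PoszM; ring.
  by rewrite lez_nat leq_mul2l cq orbT.
have qE : q.+1%:Z = q%:Z + 1 by rewrite -addn1 PoszD.
have Q0 : 0 < q%:Z + 1 by rewrite -qE.
rewrite qE in mom; rewrite -(ler_pM2l Q0).
apply: (@le_trans _ _ (q%:Z ^+ 2 * (3 * (q%:Z + 1) ^+ 2) - (q%:Z + 1) ^+ 4)).
  rewrite lerBrDr; apply: le_trans mom.
  by rewrite le_eqVlt; apply/orP; left; apply/eqP; ring.
(* After division by q + 1, the bound is 3 q^2 (q + 1) - (q + 1)^3 = 2 q^3 - 3 q - 1. *)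
rewrite -subr_ge0; have -> : (q%:Z + 1) * (2 * q%:Z ^+ 3) -
    (q%:Z ^+ 2 * (3 * (q%:Z + 1) ^+ 2) - (q%:Z + 1) ^+ 4) =
    (q%:Z + 1) * (3 * q%:Z + 1) by ring.
by rewrite mulr_ge0 // addr_ge0 // mulr_ge0.
Qed.

Lemma sum_chi_subgroup (G : {set F}) x : 0 \in G ->
  {in G &, forall g h, g + h \in G} ->
  \sum_(g in G) chi (g * x) =
  if [forall g in G, g * x \in as_img] then #|G|%:Z else 0.
Proof.
move=> G0 GD; case: ifPn => [/forall_inP Gx|].
  rewrite (eq_bigr (fun=> 1)) => [|g gG]; last by rewrite /chi Gx.
  by rewrite sumr_const natz.
rewrite negb_forall_in => /exists_inP[h hG hx]; set S := \sum_(g in G) _.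
have : S = - S.
  rewrite {1}/S (reindex_inj (addrI h)) /= -mulN1r mulr_sumr.
  apply: eq_big => [g|g _]; last by rewrite mulrDl chiD {1}/chi (negPf hx).
  apply/idP/idP => [hgG|]; last exact: GD.
  by rewrite -[g]add0r -(addff two_eq0 h) -addrA GD.
by move: S => S; lia.
Qed.

(** Let Y be the set of conic points meeting the trace conditions. Summing [conic_sum] over G x G
    gives m #|Y|; the zero pair contributes q + 1 and each other pair more than - q / m. Hence m^2
    #|Y| > q > 3 m^2. *)
Lemma conic_point (G : {set F}) (m := (#|G| ^ 2)%N) : 0 \in G ->
  {in G &, forall g h, g + h \in G} ->
  (forall g h, g \in G -> h \in G -> (g, h) != 0 ->
     m%:Z * `|conic_sum (g, h)| < q%:Z) ->
  (3 * m ^ 2 < q)%N ->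
  exists s t, [/\ s ^+ 2 + s * t + t ^+ 2 = 1, s * t * (s + t) != 0
    & {in G, forall g, g * s \in as_img /\ g * t \in as_img}].
Proof.
move=> G0 GD small big.
pose Y := [set z in conic | [forall g in G, g * z.1 \in as_img]
                           && [forall g in G, g * z.2 \in as_img]].
have countE : \sum_(k in setX G G) conic_sum k = (m * #|Y|)%:Z.
  rewrite /conic_sum exchange_big /=.
  rewrite (eq_bigr (fun z => if [forall g in G, g * z.1 \in as_img]
    && [forall g in G, g * z.2 \in as_img] then m%:Z else 0)) => [|z _].
    rewrite -big_mkcondr /= sumr_const -mulr_natr natz -PoszM.
    by congr (Posz (_ * _)); apply: eq_card => z; rewrite [RHS]inE.
  transitivity ((\sum_(g in G) chi (g * z.1)) * \sum_(h in G) chi (h * z.2)).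
    rewrite mulr_suml; under [RHS]eq_bigr do rewrite mulr_sumr.
    rewrite pair_big /=; apply: eq_big => k; first by rewrite inE.
    by rewrite /dot chiD.
  rewrite !sum_chi_subgroup //.
  by do 2 case: ifP => _; rewrite /= ?mul0r ?mulr0 // -PoszM mulnn.
have G2 : (0 < m)%N.
  by rewrite expn_gt0; apply/orP; left; apply/card_gt0P; exists 0.
have lower : q%:Z < m%:Z * (m * #|Y|)%:Z.
  rewrite -countE (bigD1 (0 : F * F)) /=; last by rewrite inE G0.
  rewrite conic_sum0 mulrDr mulr_sumr.
  have : - (\sum_(k in setX G G | k != 0) q%:Z) <=
      \sum_(k in setX G G | k != 0) m%:Z * conic_sum k.
    rewrite -sumrN; apply: ler_sum => -[g h] /andP[].
    rewrite inE /= => /andP[gG hG] gh0.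
    rewrite lerNl -mulrN; apply: (le_trans _ (ltW (small g h gG hG gh0))).
    by rewrite ler_wpM2l // -normrN ler_norm.
  rewrite sumr_const.
  have -> : #|[pred k in setX G G | k != 0]| = m.-1.
    have := cardD1 (0 : F * F) (setX G G).
    rewrite cardsX inE G0 mulnn -/m => -> /=.
    by apply: eq_card => k; rewrite !inE andbC.
  rewrite -mulr_natr natz; move: (\sum_(_ | _) _) => S.
  have -> : m%:Z = m.-1%:Z + 1 by rewrite -{1}(prednK G2) -addn1 PoszD.
  have -> : q.+1%:Z = q%:Z + 1 by rewrite -addn1 PoszD.
  move: m.-1 (q : nat) => m1 q1. nia.
have Y3 : (3 < #|Y|)%N by nia.
(* These are the only conic points with s t (s + t) = 0, so a fourth point is admissible. *)
have /subsetPn[[s t]] : ~~ (Y \subset [set (1, 0); (0, 1); (1, 1)]).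
  apply/negP => /subset_leq_card; apply/negP; rewrite -ltnNge.
  apply: leq_ltn_trans Y3; apply: leq_trans (leq_card_setU _ _) _.
  by rewrite cards2 cards1; case: (_ != _).
rewrite !inE /= => /andP[/eqP n1 /andP[/forall_inP Gs /forall_inP Gt]] ex.
exists s, t; split=> // [|g gG]; last by rewrite Gs ?Gt.
have sqr1 (a : F) : a ^+ 2 = 1 -> a = 1.
  by move/eqP; rewrite sqrf_eq1 (eq_of_addf0 two_eq0 (addNr 1)) orbb => /eqP.
apply: contra ex; rewrite !mulf_eq0 (addf_eq0 two_eq0).
move: n1; rewrite /nrm /= => n1 /orP[/orP[/eqP s0|/eqP t0]|/eqP st].
- by move: n1; rewrite s0 expr0n mul0r !add0r => /sqr1 ->; rewrite eqxx orbT.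
- by move: n1; rewrite t0 expr0n mulr0 !addr0 => /sqr1 ->; rewrite eqxx.
- by move: n1; rewrite st -expr2 addff // add0r => /sqr1 ->; rewrite eqxx orbT.
Qed.

(** If q <= m |f|, then [conic_sum_bound] gives r q^4 <= 2 m^4 q^3. *)
Lemma conic_sum_small k r (m : nat) : k != 0 ->
  injective (fun i : 'I_r => nrm k ^+ (2 ^ i)) ->
  (2 * m ^ 4 < r * q)%N -> m%:Z * `|conic_sum k| < q%:Z.
Proof.
move=> k0 injN mrq; rewrite ltNge; apply/negP => qm.
have := conic_sum_bound k0 injN; rewrite -[_ ^+ 4]ger0_norm ?exprn_even_ge0 //.
rewrite normrX; move: `|_| qm => a qm bound.
have q0 : 0 < q%:Z by rewrite ltz_nat; apply: ltn_trans (finNzRing_gt1 F).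
have q4 : q%:Z ^+ 4 <= m%:Z ^+ 4 * a ^+ 4.
  by rewrite -exprMn lerXn2r // nnegrE ?(le_trans _ qm) // ltW.
have : r%:Z * q%:Z ^+ 4 <= m%:Z ^+ 4 * (2 * q%:Z ^+ 3).
  apply: (@le_trans _ _ (m%:Z ^+ 4 * (r%:Z * a ^+ 4))).
    by rewrite [leRHS]mulrCA ler_wpM2l.
  by rewrite ler_wpM2l // exprn_even_ge0.
rewrite exprSr mulrCA [_ * (2 * _)]mulrA [_ * 2]mulrC [leRHS]mulrC.
rewrite ler_pM2l ?exprn_gt0 //.
have -> : 2 * m%:Z ^+ 4 = (2 * m ^ 4)%:Z.
  by rewrite PoszM !expnS expn0 !PoszM; ring.
by apply/negP; rewrite -ltNge -PoszM ltz_nat.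
Qed.
End ConicSums.

(** * Frobenius conjugates and norms in F_32 *)

Section DegreeFive.
Variable F : fieldType.
Hypothesis two_eq0 : 2%:R = 0 :> F.
Implicit Types a b x g h : F.

Let four_eq0 : 4%:R = 0 :> F.
Proof. by rewrite (natrM _ 2 2) two_eq0 mul0r. Qed.

Let six_eq0 : 6%:R = 0 :> F.
Proof. by rewrite (natrM _ 2 3) two_eq0 mul0r. Qed.

(** A coincidence gives x^(2^d) = x with 0 < d < 5; as d is prime to 5, this and x^32 = x give x^2 =
    x. *)
Lemma frobenius5_inj x : x != 0 -> x != 1 -> x ^+ 32 = x ->
  injective (fun i : 'I_5 => x ^+ (2 ^ i)).
Proof.
move=> x0 x1 x32.
have sq : x ^+ 2 != x by rewrite expr2 -{3}[x]mulr1 (inj_eq (mulfI x0)).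
have shift (i j : 'I_5) : (i < j)%N -> x ^+ (2 ^ i) = x ^+ (2 ^ j) -> False.
  move=> ij /(congr1 (fun y => y ^+ (2 ^ (5 - i)))).
  rewrite -!exprM -!expnD subnKC ?(ltnW (ltn_ord i)) // x32 => xE.
  have {}xE : x = x ^+ (2 ^ (j - i)).
    rewrite {1}xE -[X in (2 ^ X)%N](_ : 5 + (j - i) = _)%N.
      by rewrite expnD exprM x32.
    by move: (ltn_ord i) ij; lia.
  have : (0 < j - i < 5)%N by move: (ltn_ord j) ij; lia.
  case: (j - i)%N xE => [|[|[|[|[|d]]]]] // /esym xE _;
    move/eqP: sq; apply=> //.
  - by rewrite -{1}xE -{1}xE -!exprM.
  - by rewrite -[RHS]xE -[in RHS]xE -exprM -[in LHS]x32 -exprM.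
  - by rewrite -{1}xE -exprM.
move=> i j xE; case: (ltngtP i j) => [ij|ij|/val_inj//].
  by case: (shift i j ij xE).
by case: (shift j i ij (esym xE)).
Qed.
(** The equation between a and b says that their plane has reciprocal sum 1. Dependent pairs have
    norm x^2 with x in the plane, and all others have norm a^2 + a b + b^2. *)
Lemma nrm_plane_neq1 a b g h : a ^+ 32 = a -> a != 0 -> b != 0 -> a + b != 0 ->
  a ^+ 2 + a * b + b ^+ 2 = a * b * (a + b) ->
  g \in [:: 0; a; b; a + b] -> h \in [:: 0; a; b; a + b] -> nrm (g, h) != 1.
Proof.
move=> a32 a0 b0 ab0 e3 gP hP.
have sqr1 x : x ^+ 2 == 1 -> x = 1.
  by rewrite sqrf_eq1 (eq_of_addf0 two_eq0 (addNr 1)) orbb => /eqP.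
(* At c = 1 the relation reads 1 + d + d^2 = d + d^2. *)
have not_one (c d : F) : c ^+ 2 + c * d + d ^+ 2 = c * d * (c + d) -> c != 1.
  move=> cd; apply/eqP => c1; have /eqP : 1 = 0 :> F.
    by rewrite -[RHS](subrr (c * d * (c + d))) -{1}cd c1; ring.
  by rewrite oner_eq0.
have a1 : a != 1 by apply: (not_one a b).
have b1 : b != 1.
  by apply: (not_one b a); rewrite [b + a]addrC [b * a]mulrC -e3; ring.
have ab1 : a + b != 1.
  apply: (not_one _ a); apply: (eq_of_addf0 two_eq0).
  transitivity (a ^+ 2 + a * b + b ^+ 2 + a * b * (a + b)); last first.
    by rewrite e3 addff.
  apply: (eq_of_addf0 two_eq0).
  by ring: two_eq0 four_eq0 six_eq0.
(* Otherwise a is a root of X^3 + X + 1, so lies in F_8, which meets F_32 only in F_2. *)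
have e1 : a ^+ 2 + a * b + b ^+ 2 != 1.
  apply/eqP => e1; have a3 : a ^+ 3 = a + 1.
    have : a * (a ^+ 2 + a * b + b ^+ 2) = a ^+ 3 + a * b * (a + b) by ring.
    rewrite -e3 e1 mulr1 => aE; apply: (eq_of_addf0 two_eq0).
    by rewrite [a + 1]addrC addrA -aE addff.
  have a7 : a ^+ 7 = 1.
    rewrite (exprD _ 1 6) (exprM _ 3 2) a3 sqrfD // expr1n mulrDr mulr1.
    by rewrite -exprS a3 addrAC addff // add0r.
  have a31 : a ^+ 31 = 1 by apply: (mulfI a0); rewrite -exprS a32 mulr1.
  have : a ^+ 3 = 1.
    by rewrite -[RHS]a31 (exprD _ 3 28) (exprM _ 7 4) a7 expr1n mulr1.
  by rewrite a3 => /eqP; rewrite -subr_eq0 addrK (negPf a0).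
have nE (x y : F) : nrm (x, y) = x ^+ 2 + x * y + y ^+ 2 by [].
have n0 (x : F) : x != 1 ->
    nrm (0, x) != 1 /\ nrm (x, 0) != 1 /\ nrm (x, x) != 1.
  move=> x1; rewrite !nE !mul0r !mulr0 expr0n !add0r !addr0 -expr2.
  rewrite addff // add0r.
  by do ![split]; apply: contraNneq x1 => /eqP/sqr1 ->.
have sym (x y : F) : nrm (x, y) = nrm (y, x) by rewrite !nE; ring.
have third (x y : F) : nrm (x, x + y) = nrm (x, y).
  by rewrite !nE; apply: (eq_of_addf0 two_eq0); ring: two_eq0 four_eq0 six_eq0.
have z1 : nrm ((0 : F), 0) != 1.
  by rewrite nE !mulr0 expr0n !addr0 eq_sym oner_eq0.
have [a2 [a2' a2'']] := n0 a a1; have [b2 [b2' b2'']] := n0 b b1.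
have [c2 [c2' c2'']] := n0 _ ab1.
move: gP hP; rewrite !inE => /or4P[]/eqP-> /or4P[]/eqP-> //.
- by rewrite third.
- by rewrite sym.
- by rewrite addrC third sym.
- by rewrite sym third.
- by rewrite sym addrC third sym.
Qed.
End DegreeFive.

(** * Vanishing subspaces of dimensions 3 and 4 *)

Section Existence.
Variable L : fieldExtType 'F_2.
Local Notation K := (finvect_type L).
Local Notation n := (\dim {:L}).
Hypothesis n_odd : odd n.

Let two_eq0 : 2%:R = 0 :> K := two_eq0_ext K.
Let neq1 (x : K) : x ^+ 2 + x != 1 := sqrD1_neq1 n_odd x.

Lemma vanishing_extend (s : seq K) : free s -> srecip s = 1 ->
  (3 * (2 ^ (4 * size s)) < 2 ^ n)%N ->
  (forall g h, g \in <<s>>%VS -> h \in <<s>>%VS -> (g, h) != 0 ->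
     (4 ^ size s)%:Z * `|conic_sum (g, h)| < (2 ^ n)%:Z) ->
  vanishing K (size s + 2).
Proof.
move=> fs rs big small; pose G := [set g in <<s>>%VS].
have cG : (#|G| ^ 2 = 4 ^ size s)%N.
  rewrite cardsE card_vspace card_Fp // (eqP fs) -expnM mulnC expnM //.
have [||g h||x [y [n1 D0 Gxy]]] := @conic_point K two_eq0 neq1 G.
- by rewrite inE mem0v.
- by move=> g h; rewrite !inE; apply: memvD.
- by rewrite !inE cG card_ext; apply: small.
- rewrite cG card_ext (_ : (4 ^ size s) ^ 2 = 2 ^ (4 * size s))%N //.
  by rewrite -[4%N in LHS]/(2 ^ 2)%N -!expnM; congr (2 ^ _)%N; lia.
pose D := x * y * (x + y).
(* The entries (D g)^2 are values of the plane's polynomial, and t has reciprocal sum D^-2, so the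
   total is 1 / D + D / D^2 = 0. *)
pose t := map ( *%R (D ^+ 2)) (map (fun g => g ^+ 2) s).
have ft : free t.
  rewrite free_scale ?expf_neq0 // free_sprod sprod_sqr //.
  by rewrite expf_neq0 // -free_sprod.
have fxy : free [:: y; x].
  rewrite free_sprod (_ : sprod _ = D) //; rewrite /D /=; ring.
have rt : srecip t = (D ^+ 2)^-1.
  by rewrite srecip_scale ?expf_neq0 // srecip_sqr // rs expr1n mulr1.
have r0 : srecip [:: y; x] + sprod [:: y; x] * srecip t = 0.
  rewrite rt srecip_plane // (_ : sprod _ = D); last by rewrite /D /=; ring.
  exact: addf_inv_sqr.
have -> : (size s + 2 = size t + size [:: y; x])%N by rewrite !size_map.
apply: vanishing_cat => // _ /mapP[_ /mapP[g gs ->] ->].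
have [] := Gxy g _; first by rewrite inE memv_span.
move=> /as_imgP[p gp] /as_imgP[r gr]; apply/spoly_imgP.
exists (y * p + x * r); exact/esym/(spoly_plane two_eq0 gp gr).
Qed.

(** Here G = F_2 and m = 4, so the character bound requires 2 * 4^4 = 2^9 < 2^n. *)
Lemma vanishing3 : (9 < n)%N -> vanishing K 3.
Proof.
move=> n9; apply: (@vanishing_extend [:: 1]).
- by rewrite free_sprod /= mul1r oner_eq0.
- by rewrite /= add0r mul1r invr1.
- by rewrite /= (leq_trans _ (leq_pexp2l _ n9)).
move=> g h; rewrite !span_seq1 => /vlineP[c ->] /vlineP[d ->] gh0 /=.
rewrite -card_ext; apply: (@conic_sum_small K two_eq0 neq1 _ 1) => //.
  by move=> i j _; rewrite !ord1.
by rewrite mul1n card_ext (leq_trans _ (leq_pexp2l _ n9)).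
Qed.
Lemma vanishing4 (E : {subfield K}) : (14 < n)%N -> \dim E = 5 -> vanishing K 4.
Proof.
move=> n14 dE.
have [b bE b1] : exists2 b, b \in E & b \notin 1%VS.
  by apply/subvPn/negP => /dimvS; rewrite dimv1 dE.
have fb : free [:: b; 1] by rewrite free_cons span_seq1 b1 seq1_free oner_eq0.
have r0 : srecip [:: b; 1] != 0.
  by apply: (srecip2_neq0 two_eq0 neq1); rewrite -free_sprod.
(* Scaling a plane by its own reciprocal sum, an element of E, normalizes that sum to 1. *)
pose s := map ( *%R (srecip [:: b; 1])) [:: b; 1].
have fs : free s by apply: free_scale.
have rs : srecip s = 1 by rewrite srecip_scale // mulVf.
have sE : {subset <<s>>%VS <= E}.
  apply/subvP/span_subvP => _ /mapP[x xb ->]; apply: rpredM.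
    by rewrite /= add0r !mul1r rpredD ?rpredV ?rpredM ?rpredD ?rpred1.
  by move: xb; rewrite !inE => /orP[]/eqP->; rewrite ?bE ?mem1v.
have powE x : x \in E -> x ^+ 32 = x.
  by rewrite Fermat's_little_theorem card_Fp // dE => /eqP.
apply: (@vanishing_extend s) => //.
  by rewrite /= (leq_trans _ (leq_pexp2l _ n14)).
move=> g h gs hs gh0.
have N0 : nrm (g, h) != 0 by rewrite nrm_eq0.
have N32 : nrm (g, h) ^+ 32 = nrm (g, h).
  by apply: powE; rewrite /nrm /= rpredD ?rpredD ?rpredX ?rpredM ?sE.
have N1 : nrm (g, h) != 1.
  have [w [v swv]] : exists w v, s = [:: w; v] by do 2 eexists.
  move: fs rs sE gs hs; rewrite {}swv free_sprod => wv rwv sE gs hs.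
  have := srecip2_mul_sprod wv; rewrite rwv mul1r /= !mul1r => e3.
  move: wv; rewrite /= !mul1r !mulf_eq0 !negb_or => /and3P[v0 w0 wv0].
  have memP x : x \in <<[:: w; v]>>%VS -> x \in [:: 0; w; v; w + v].
    have eqE c : (x + c == 0) = (x == c) by apply: addf_eq0.
    rewrite !mem_span_cons span_nil !memv0 !inE -addrA !eqE.
    by case/orP=> /orP[] ->; rewrite ?orbT.
  apply: (nrm_plane_neq1 two_eq0 (a := w) (b := v)) => //; try exact: memP.
    by apply: powE; apply: sE; rewrite memv_span ?mem_head.
  by rewrite -e3; ring.
rewrite -card_ext; apply: (@conic_sum_small K two_eq0 neq1 _ 5) => //.
  exact: frobenius5_inj.
(* With m = 16 and r = 5: 2 * 16^4 = 4 * 2^15 < 5 * 2^15 <= 5 * 2^n. *)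
rewrite card_ext; apply: (@leq_trans (5 * 2 ^ 15)).
  rewrite -[X in (2 * X ^ 4)%N]/(2 ^ 4)%N -expnM -expnS.
  by rewrite (ltn_mul2r (2 ^ 15) 4 5).
by rewrite leq_mul2l leq_pexp2l.
Qed.
End Existence.

(** * Assembly of all dimensions by residue modulo 5 *)

Theorem theorem3p13 (n : nat) (L : fieldExtType 'F_2) (dimL : \dim {:L} = n)
    (n_ge7 : (7 <= n)%N) (n_odd : odd n) (n_dvd5 : (5 %| n)%N) :
  forall k : nat, calK L k <-> (3 <= k <= n - 3)%N.
Proof.
move=> k; pose K := finvect_type L.
have oddL : odd (\dim {:L}) by rewrite dimL.
have [E dE] : exists E : {subfield K}, \dim E = 5.
  by apply: finField_subfield; rewrite -dimL in n_dvd5.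
have van3 : vanishing K 3 by apply: vanishing3 => //; rewrite dimL; lia.
have van4 : vanishing K 4.
  by apply: (@vanishing4 _ _ E) => //; rewrite dimL; lia.
have add j i : (j * i < n)%N ->
    vanishing K j -> vanishing K i -> vanishing K (j + i).
  by rewrite -dimL; apply: vanishing_add.
have mod5 j i : (5 * (j + i) <= n)%N ->
    vanishing K j -> vanishing K (j + 5 * i).
  have := @vanishing_add_module L E j i.
  by rewrite dE dimL [(_ * 5)%N]mulnC [(i * 5)%N]mulnC => h ? ?; apply: h.
have dual j : (j <= n)%N -> vanishing K (n - j) -> vanishing K j.
  move=> jn vj; rewrite -(subKn jn) -{1}dimL; apply: vanishing_dual => //.
  by rewrite dimL; lia.
have van0 : vanishing K 0 by exists [::]; rewrite nil_free.
have van6 : vanishing K 6 by apply: (add 3 3) => //; lia.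
have van7 : vanishing K 7 by apply: (add 3 4) => //; lia.
(* 11 = (3 + 5) + 3, the last gluing requiring 8 * 3 < n. *)
have van11 : (25 <= n)%N -> vanishing K 11.
  move=> n25; apply: (add 8 3) => //.
  by apply: (mod5 3 1) => //; lia.
have no1 : ~ vanishing K 1.
  case=> -[|w [|? ?]] [] // _ fw /eqP; apply/negP.
  by apply: srecip1_neq0; rewrite -free_sprod.
have no2 : ~ vanishing K 2.
  case=> -[|w [|v [|? ?]]] [] // _ fw /eqP; apply/negP.
  apply: (srecip2_neq0 (two_eq0_ext K) (sqrD1_neq1 oddL)).
  by rewrite -free_sprod.
rewrite calK_vanishing dimL; split=> [[kn vk]|kn].
  have k12 : k <> 1%N /\ k <> 2%N.
    by split=> kE; rewrite kE in vk; [apply: no1 | apply: no2].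
  have kn1 : k <> n.-1.
    by move=> kE; rewrite kE in vk; apply/no1/dual; [lia | rewrite subn1].
  have kn2 : k <> (n - 2)%N.
    by move=> kE; rewrite kE in vk; apply/no2/dual => //; lia.
  lia.
split; first lia.
have [m nE] : exists m, n = (5 * m)%N.
  by case/dvdnP: n_dvd5 => m ->; exists m; rewrite mulnC.
have m_odd : odd m by move: n_odd; rewrite nE oddM.
(* Adding E-lines to dimension 3 reaches j <= m - 3; the one case left, j = m - 2, is dual to 7. *)
have A j : (5 * j + 3 <= n - 3)%N -> vanishing K (3 + 5 * j).
  move=> jn; have [jm|jm] := leqP j (m - 3); first by apply: mod5 => //; lia.
  by apply: dual; first lia; rewrite (_ : _ - _ = 7)%N //; lia.
(* Adding E-lines to dimension 4 reaches j <= m - 4; the cases m - 3 and m - 2 are dual to 11 and 6.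
   The first has j >= 1, so m >= 4, and m odd gives n >= 25. *)
have B j : (5 * j + 4 <= n - 3)%N -> vanishing K (4 + 5 * j).
  move=> jn; case: j jn => [|j] jn; first by rewrite muln0 addn0.
  have [jm|jm] := leqP j.+1 (m - 4); first by apply: mod5 => //; lia.
  have [jE|jE] : j.+1 = (m - 3)%N \/ j.+1 = (m - 2)%N by lia.
    by apply: dual; first lia; rewrite (_ : _ - _ = 11)%N; [apply: van11|]; lia.
  by apply: dual; first lia; rewrite (_ : _ - _ = 6)%N //; lia.
(* Residue 0 is an F_32-subspace, 1 and 2 are dual to 4 and 3, and 3 and 4 are [A] and [B]. *)
have := divn_eq k 5; have := ltn_pmod k (isT : 0 < 5)%N.
move: (k %/ 5)%N (k %% 5)%N => j [|[|[|[|[|?]]]]] // _ kE.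
- by rewrite kE addn0 mulnC -[(5 * j)%N]add0n; apply: mod5 => //; lia.
- apply: dual; first lia; rewrite (_ : n - k = 4 + 5 * (m - j.+1))%N; last lia.
  by apply: B; lia.
- apply: dual; first lia; rewrite (_ : n - k = 3 + 5 * (m - j.+1))%N; last lia.
  by apply: A; lia.
- by rewrite kE addnC mulnC; apply: A; lia.
- by rewrite kE addnC mulnC; apply: B; lia.
Qed.
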